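(* Let $\alpha$ be a fractional set with $\|\alpha\|>1$, let $k$ be a nonzero integer, and for each $n\ge 1$ suppose $S_n\subseteq\mathbb{Z}^n$ is drawn from $\alpha^n$. Let $\gamma=\alpha+k\cdot\alpha$, and suppose that $\gamma$ is strictly spartan, in the sense that $$\sum_{m\in\mathrm{supp}(\gamma)}\gamma(m)\log\gamma(m)<0.$$ Then, with probability tending to $1$ as $n\to\infty$, $$|S_n+k\cdot S_n|\ge\tfrac12|S_n|^2\quad\text{if }k\ne 1,\qquad |S_n+k\cdot S_n|\ge\tfrac14|S_n|^2\quad\text{if }k=1.$$
   Context: A fractional dilate is a map $\gamma:\mathbb{Z}\to[0,\infty)$ with finite support $\mathrm{supp}(\gamma)$. Its size is $\|\gamma\|=\inf_{0\le p\le 1}\sum_{n\in\mathrm{supp}(\gamma)}\gamma(n)^p$. A fractional set is a fractional dilate $\alpha$ with $\alpha(n)\le 1$ for all $n\in\mathbb{Z}$. For fractional sets $\alpha,\beta$ and an integer $k$, $\alpha+k\cdot\beta$ is the fractional dilate $(\alpha+k\cdot\beta)(n)=\sum_{(i,j):\,i+kj=n}\alpha(i)\beta(j)$. A random set $S_n\subseteq\mathbb{Z}^n$ is drawn from $\alpha^n$ if each element of $\mathbb{Z}^n$ is chosen independently, and $(i_1,\dots,i_n)$ is chosen with probability $\alpha(i_1)\alpha(i_2)\cdots\alpha(i_n)$. For $A,B\subseteq\mathbb{Z}^n$, $A+k\cdot B=\{a+kb:a\in A,b\in B\}$. *)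

(* Defs.v *)
From HB Require Import structures.
From mathcomp Require Import all_boot all_order all_algebra finmap.
From mathcomp Require Import all_classical all_reals all_analysis.

Set Implicit Arguments.
Unset Strict Implicit.
Unset Printing Implicit Defensive.

Import Order.TTheory GRing.Theory Num.Theory.
Import numFieldNormedType.Exports.

Local Open Scope classical_set_scope.
Local Open Scope ring_scope.

Definition supp {R : realType} (gamma : int -> R) : set int :=
  [set n | gamma n != 0].

Definition fractional_dilate {R : realType} (gamma : int -> R) : Prop :=
  finite_set (supp gamma) /\ (forall n, 0 <= gamma n).

Definition fractional_set {R : realType} (alpha : int -> R) : Prop :=
  fractional_dilate alpha /\ (forall n, alpha n <= 1).

(* The sum runs over the support only, so the convention 0 `^ 0 = 1 plays no
   role: at p = 0 each point of the support contributes 1. *)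
Definition dilate_size {R : realType} (gamma : int -> R) : R :=
  inf [set \sum_(n \in supp gamma) gamma n `^ p | p in `[0, 1]].

(* The index set is infinite; [\sum_(_ \in _)] restricts it to the nonzero
   terms, of which there are finitely many when alpha and beta have finite
   support. *)
Definition dilate_add {R : realType} (alpha : int -> R) (k : int)
    (beta : int -> R) : int -> R :=
  fun n => \sum_(ij \in [set ij : int * int | ij.1 + k * ij.2 = n])
             alpha ij.1 * beta ij.2.

(* The natural logarithm; the sign of the sum does not depend on the base. *)
Definition strictly_spartan {R : realType} (gamma : int -> R) : Prop :=
  \sum_(m \in supp gamma) gamma m * ln (gamma m) < 0.

Definition sumset_dilate {n : nat} (A : set 'rV[int]_n) (k : int)
    (B : set 'rV[int]_n) : set 'rV[int]_n :=
  [set a + k *: b | a in A & b in B].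

Definition mutually_independent {d : measure_display} {T : measurableType d}
    {R : realType} (P : probability T R) {I : choiceType} (E : I -> set T) :
    Prop :=
  forall J : {fset I},
    P (\bigcap_(i in [set` J]) E i) = (\prod_(i <- J) P (E i))%E.

Definition drawn_from_power {d : measure_display} {T : measurableType d}
    {R : realType} (P : probability T R) (alpha : int -> R) {n : nat}
    (S : T -> set 'rV[int]_n) : Prop :=
  [/\ forall x, measurable [set w | S w x],
      forall x, P [set w | S w x] = (\prod_(i < n) alpha (x ord0 i))%:E
    & mutually_independent P (fun x => [set w | S w x])].

(* Cardinalities are extended real: S w is almost surely, but possibly not
   surely, finite. *)
Definition large_sumset {R : realType} {d : measure_display} {T : measurableType d}
    {n : nat} (c : R) (k : int) (S : T -> set 'rV[int]_n) : set T :=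
  [set w | (c%:E * counting (S w) ^+ 2
            <= counting (sumset_dilate (S w) k (S w)))%E].

(* Main.v *)
Require Import Defs.
From HB Require Import structures.
From mathcomp Require Import all_boot all_order all_algebra finmap.
From mathcomp Require Import all_classical all_reals all_analysis.
From mathcomp Require Import zify ring lra.
Import Order.TTheory GRing.Theory Num.Theory.
Import numFieldNormedType.Exports.
Local Open Scope classical_set_scope.
Local Open Scope ring_scope.

(** Let [A] be the sum of [alpha], which exceeds 1, and let [D] be the [n]-th power
    of the support of [alpha]. Almost surely [S_n] lies in [D], and by Chebyshev's
    inequality ([chebyshev_subset]) its cardinality [N] is at least [A ^ n / 2]
    with probability tending to 1. There are [N ^ 2] pairs in [S_n], and it
    suffices to show that, apart from [o(A ^ (2 n))] pairs, the only coincidences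
    among the sums [f + k g] are those between [(f, g)] and [(g, f)] when [k = 1].
    The inequality [2 u c <= u ^ 2 + c ^ 2] between a multiplicity [c] and its
    typical value [u] ([u = 2] if [k = 1], and [u = 1] otherwise) then turns a
    count of coincidences into a lower bound for the number of sums
    ([distinct_values_ge], [card_sums_ge]), with a factor 2 to spare.

    The expected number of coincidences may be far larger than [A ^ (2 n)], owing
    to a few sums with very many representations. Pairs with such a sum are
    therefore removed first. A sum [m] has about [gamma ^ n (m)] representations
    in expectation; along a pair drawn with probability proportional to
    [alpha ^ n (f) alpha ^ n (g)], the logarithm of [gamma ^ n (f + k g)] is a sum
    of independent terms whose mean is negative, which is precisely the strictly
    spartan hypothesis. Hence, by a Chernoff bound ([exists_exp_moment_lt],
    [dense_weight]), all but an exponentially small proportion of the pairs have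
    [gamma ^ n (f + k g) <= exp (- eps n)]; and the coincidences of four distinct
    points involving such a sparse pair number at most [exp (- eps n) A ^ (2 n)]
    in expectation ([quad_weight]).

    Coincidences [f + k g = h + k f] between pairs sharing a point remain. Here [h]
    is determined by [f] and [g], so their expected number is the [n]-th power of
    a quantity which is at most [A ^ 2], and which is less than that unless
    [alpha] is the indicator function of its support, a case that is not spartan
    ([chain_mass_lt], [triple_weight]).

    Expectations are finite sums over the subsets of [D], weighted by the law of
    the trace of [S_n] on [D]. The passage from these sums to the given probability
    space requires the event of the theorem to be measurable
    ([measurable_large_sumset]), which holds because [S_n] either is infinite or is
    one of countably many finite sets. *)

Set Implicit Arguments.
Unset Strict Implicit.
Unset Printing Implicit Defensive.

(** * Two inequalities *)

(** A value of multiplicity [c] contributes [c] to [size s] and [c ^ 2] to the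
    last sum, so this is [2 * u * c <= u ^ 2 + c ^ 2] summed over the distinct
    values. It is sharp when every value has multiplicity [u], and thus gives a
    good lower bound when almost all coincidences are forced to come in groups
    of size [u]. *)
Lemma distinct_values_ge (T : eqType) (u : nat) (s : seq T) :
  (2 * u * size s <= u ^ 2 * size (undup s) + \sum_(x <- s) count_mem x s)%N.
Proof.
rewrite -(big_undup_iterop_count _ s)/=.
have -> : size s = (\sum_(x <- undup s) count_mem x s)%N.
  rewrite -[LHS]sum1_size -big_undup_iterop_count/=.
  by apply: eq_bigr => x _; rewrite Monoid.iteropE iter_addn addn0 mul1n.
rewrite -[size (undup s)]sum1_size !big_distrr/= -big_split/=.
apply: leq_sum => x _.
rewrite Monoid.iteropE iter_addn addn0 muln1.
by set c := count_mem x s; rewrite -mulnA mulnn (nat_Cauchy u c).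
Qed.

(** The two sides agree at [p = 0], where the derivative of the left one is the
    negative number [\sum_i c i * l i]. *)
Lemma exists_exp_moment_lt (R : realType) (I : finType) (c l : I -> R) :
  (forall i, 0 <= c i) -> \sum_i c i * l i < 0 ->
  exists2 p : R, 0 < p & \sum_i c i * expR (p * l i) < \sum_i c i.
Proof.
move=> c0 cl0.
pose m := \sum_i `|l i|; pose q := \sum_i c i * l i ^+ 2.
have m0 : 0 <= m by apply: sumr_ge0 => i _; exact: normr_ge0.
have q0 : 0 <= q by apply: sumr_ge0 => i _; rewrite mulr_ge0 ?sqr_ge0.
have lm i : `|l i| <= m by rewrite /m (bigD1 i)//= lerDl sumr_ge0.
set e := - (\sum_i c i * l i); have e0 : 0 < e by rewrite oppr_gt0.
(* The first bound on p keeps p * l i within [-1/2, 1/2], the second makes the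
   quadratic error 2 * p ^+ 2 * q smaller than the linear gain p * e. *)
pose p := Num.min (2 * (m + 1))^-1 (e / (4 * (q + 1))).
have p0 : 0 < p by rewrite lt_min invr_gt0 divr_gt0//; nra.
have pm : p * m <= 2^-1.
  have : p <= (2 * (m + 1))^-1 by rewrite ge_min lexx.
  move=> /(ler_wpM2r m0)/le_trans; apply.
  by rewrite mulrC ler_pdivrMr; lra.
have pq : p * (4 * (q + 1)) <= e.
  by rewrite -ler_pdivlMr ?ge_min ?lexx ?orbT//; lra.
exists p => //.
(* This follows from expR x <= 1 / (1 - x), which is expR (- x) >= 1 - x. *)
have expB (x : R) : `|x| <= 2^-1 -> expR x <= 1 + x + 2 * x ^+ 2.
  move=> /ler_normlP[xl xu].
  have x1 : 0 < 1 - x by lra.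
  have := expR_ge1Dx (- x); rewrite expRN => h.
  have e1 : expR x <= (1 - x)^-1.
    by rewrite -(invrK (expR x)) lef_pV2// posrE ?invr_gt0 ?expR_gt0.
  apply: (le_trans e1); rewrite -[leLHS]mul1r ler_pdivrMr//.
  nra.
apply: (@le_lt_trans _ _
  (\sum_i (c i + p * (c i * l i) + 2 * p ^+ 2 * (c i * l i ^+ 2)))).
  apply: ler_sum => i _.
  have -> : c i + p * (c i * l i) + 2 * p ^+ 2 * (c i * l i ^+ 2) =
    c i * (1 + p * l i + 2 * (p * l i) ^+ 2) by ring.
  apply: ler_wpM2l => //; apply: expB.
  rewrite normrM (gtr0_norm p0); apply: le_trans pm.
  by rewrite ler_pM2l.
rewrite !big_split/= -!big_distrr/= -/q.
have -> : \sum_i c i * l i = - e by rewrite /e opprK.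
suff : 2 * p ^+ 2 * q < p * e by lra.
have : p * (p * (4 * (q + 1))) <= p * e by rewrite ler_pM2l.
nra.
Qed.

(** * Moments of a random subset of a finite set *)

Section RandomSubset.
Variables (R : realType) (D : finType) (w : D -> R) (p : {set D} -> R).
Hypotheses (w0 : forall x, 0 <= w x) (p0 : forall F, 0 <= p F).
(* p is the law of a random subset F of D; independence is used only through the
   probabilities that F contains a given set. *)
Hypothesis p_incl : forall J : {set D},
  \sum_(F : {set D} | J \subset F) p F = \prod_(x in J) w x.

Lemma sum_law : \sum_F p F = 1.
Proof.
have := p_incl finset.set0; rewrite big_set0 => <-.
by apply: eq_bigl => F; rewrite finset.sub0set.
Qed.

(** Linearity of expectation: the expected number of configurations lying inside
    the random set. Repeated points of a configuration count once, whence the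
    [undup]. *)
Lemma expected_count (I : finType) (C : pred I) (s : I -> seq D) :
  \sum_F p F * #|[set i | C i & all [in F] (s i)]|%:R =
  \sum_(i | C i) \prod_(x <- undup (s i)) w x.
Proof.
transitivity (\sum_(i | C i) \sum_(F : {set D} | all [in F] (s i)) p F).
  under [RHS]eq_bigr do rewrite big_mkcond.
  rewrite exchange_big/=; apply: eq_bigr => F _.
  rewrite -big_mkcondr/= sumr_const mulr_natr.
  by congr (_ *+ _); apply: eq_card => i; rewrite !inE.
apply: eq_bigr => i _; rewrite big_uniq ?undup_uniq//=.
transitivity (\prod_(x in [set x in s i]%SET) w x); last first.
  by apply: eq_bigl => x; rewrite inE mem_undup.
rewrite -p_incl; apply: eq_bigl => F.
apply/allP/fintype.subsetP => sF x; first by rewrite inE => /sF.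
by move=> xs; apply: sF; rewrite inE.
Qed.

Lemma markov_subset (t : R) (g : {set D} -> R) (E : pred {set D}) : 0 < t ->
  (forall F, 0 <= g F) -> (forall F, E F -> t <= g F) ->
  \sum_(F | E F) p F <= (\sum_F p F * g F) / t.
Proof.
move=> t0 g0 Eg; rewrite ler_pdivlMr// big_distrl/= [leRHS](bigID E)/=.
rewrite -[leLHS]addr0 lerD//; last by apply: sumr_ge0 => F _; rewrite mulr_ge0.
by apply: ler_sum => F /Eg; exact: ler_wpM2l.
Qed.

(** The second moment of [#|F|] counts ordered pairs; a pair [(x, x)] contributes
    [w x] and the others multiply, so the variance is at most the mean. *)
Lemma chebyshev_subset : let mu := \sum_x w x in 0 < mu ->
  \sum_(F : {set D} | #|F|%:R < mu / 2) p F <= 4 / mu.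
Proof.
move=> mu mu0.
have E1 : \sum_F p F * #|F|%:R = mu.
  transitivity (\sum_F p F * #|[set x | true & all [in F] [:: x]]|%:R).
    apply: eq_bigr => F _; congr (_ * _%:R).
    by apply: eq_card => x; rewrite inE/= andbT.
  rewrite (expected_count predT (fun x => [:: x])).
  by apply: eq_bigr => x _; rewrite big_seq1.
have E2 : \sum_F p F * (#|F|%:R ^+ 2) <= mu + mu ^+ 2.
  have -> : \sum_F p F * (#|F|%:R ^+ 2) =
      \sum_F p F * #|[set q : D * D | true & all [in F] [:: q.1; q.2]]|%:R.
    apply: eq_bigr => F _; rewrite -natrX -mulnn -cardsX; congr (_ * _%:R).
    by apply: eq_card => q; rewrite !inE/= andbT.
  rewrite (expected_count predT (fun q : D * D => [:: q.1; q.2]))/=.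
  rewrite -(pair_bigA _ (fun f g => \prod_(x <- undup [:: f; g]) w x))/=.
  have -> : mu + mu ^+ 2 = \sum_x (w x + \sum_y w x * w y).
    rewrite big_split/= expr2 {3}/mu big_distrl/=; congr (_ + _).
    by apply: eq_bigr => x _; rewrite big_distrr.
  apply: ler_sum => x _; rewrite (bigD1 x)//= mem_head big_seq1 lerD//.
  rewrite [leRHS](bigD1 x)//= -[leLHS]add0r lerD ?mulr_ge0//.
  apply: ler_sum => y yx.
  by rewrite mem_seq1 eq_sym (negbTE yx) big_cons big_seq1.
have t0 : 0 < mu ^+ 2 / 4 by nra.
apply: (le_trans (@markov_subset _ (fun F => (#|F|%:R - mu) ^+ 2) _ t0 _ _)).
- by move=> F; exact: sqr_ge0.
- by move=> F; set x := #|F|%:R; have : 0 <= x by []; nra.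
- have -> : \sum_F p F * (#|F|%:R - mu) ^+ 2 = \sum_F p F * #|F|%:R ^+ 2 - mu ^+ 2.
    transitivity (\sum_F (p F * #|F|%:R ^+ 2 - 2 * mu * (p F * #|F|%:R) +
        mu ^+ 2 * p F)).
      by apply: eq_bigr => F _; ring.
    by rewrite !big_split/= sumrN -!big_distrr/= E1 sum_law; ring.
  apply: (@le_trans _ _ (mu / (mu ^+ 2 / 4))).
    by rewrite ler_pM2r ?invr_gt0//; lra.
  by rewrite le_eqVlt; apply/orP; left; apply/eqP; field; lra.
Qed.

End RandomSubset.

(** * Coincidences among sums of pairs *)

Section Collisions.
Variables (n : nat) (D : finType) (e : D -> 'rV[int]_n) (k : int).
Variable sparse : pred (D * D).
Hypotheses (e_inj : injective e) (k0 : k != 0).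

Definition dsum (q : D * D) : 'rV[int]_n := e q.1 + k *: e q.2.

Definition pair_pts (q : D * D) : seq D := [:: q.1; q.2].
(** The predicate [sparse] stands for the pairs whose sum is expected to be hit
    rarely; the others are to be discarded. *)
Definition dense_pair (q : D * D) : bool := uniq (pair_pts q) && ~~ sparse q.

Definition quad_pts (z : (D * D) * (D * D)) : seq D :=
  pair_pts z.1 ++ pair_pts z.2.
Definition sparse_quad (z : (D * D) * (D * D)) : bool :=
  [&& uniq (quad_pts z), sparse z.1 & dsum z.1 == dsum z.2].

Definition triple_pts (t : (D * D) * D) : seq D := [:: t.1.1; t.1.2; t.2].
(** Two pairs with equal sums that share exactly one point share it in opposite
    positions, and so have the form [(f, g)] and [(h, f)]. *)
Definition chain_triple (t : (D * D) * D) : bool :=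
  uniq (triple_pts t) && (dsum t.1 == dsum (t.2, t.1.1)).

Lemma dsum_injl (f g h : D) : dsum (f, g) = dsum (f, h) -> g = h.
Proof.
move=> /addrI/matrixP E; apply: e_inj; apply/matrixP => i j.
by have := E i j; rewrite !mxE => /(mulfI k0).
Qed.

Lemma dsum_injr (f g h : D) : dsum (f, h) = dsum (g, h) -> f = g.
Proof. by move=> /addIr/e_inj. Qed.

Lemma dsum_swap (f g : D) : f != g -> dsum (f, g) = dsum (g, f) -> k = 1.
Proof.
move=> fg E; apply/eqP; rewrite -subr_eq0; apply/negPn/negP => k1.
move/eqP: fg; apply; apply: e_inj; apply/matrixP => i j.
have := congr1 (fun A : 'rV[int]_n => A i j) E; rewrite !mxE/=.
move=> {}E; apply: (mulfI k1).
by apply: (@addIr _ (e f i j + e g i j)); move: E; lia.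
Qed.

(** The number of ordered pairs [(f, g)], [f != g], that share a sum for a
    structural reason: [(f, g)] and [(g, f)] when [k = 1]. *)
Definition sum_multiplicity : nat := if k == 1 then 2 else 1.

Definition sums (F : {set D}) : seq 'rV[int]_n :=
  undup [seq dsum q | q <- enum (finset.setX F F)].

Definition few_sums (F : {set D}) : bool :=
  (2 * sum_multiplicity * size (sums F) < #|F| ^ 2)%N.

(** Apply [distinct_values_ge] to the sums of the sparse pairs of distinct points
    of [F]. Two such pairs with the same sum are equal, or are swaps of each other
    (which forces [k = 1]), or form a chain triple in one of two orders, or
    consist of four distinct points. The pairs left out are the diagonal ones,
    which give the term [#|F|], and the dense ones. *)
Lemma card_sums_ge (F : {set D}) :
  (#|F| ^ 2 <= sum_multiplicity * size (sums F) + #|F|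
     + #|[set q | dense_pair q & all [in F] (pair_pts q)]|
     + #|[set z | sparse_quad z & all [in F] (quad_pts z)]|
     + 2 * #|[set t | chain_triple t & all [in F] (triple_pts t)]|)%N.
Proof.
set B := [set q | dense_pair q & _]%SET.
set Z := [set z | sparse_quad z & _]%SET.
set U := [set t | chain_triple t & _]%SET.
set u := sum_multiplicity.
pose Q := [set q in finset.setX F F | uniq (pair_pts q) && sparse q]%SET.
have FQ : (#|F| ^ 2 <= #|Q| + #|F| + #|B|)%N.
  rewrite -mulnn -cardsX.
  rewrite -(card_imset F (f := fun f => (f, f))); last by move=> f g [].
  have : finset.setX F F \subset (Q :|: [set (f, f) | f in F]%SET :|: B)%SET.
    apply/fintype.subsetP => -[f g]; rewrite !inE/= => /andP[fF gF]; rewrite !fF !gF/=.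
    rewrite /dense_pair/= !inE !andbT; have [->|fg]/= := eqVneq f g.
      by rewrite imset_f.
    by case: (sparse _); rewrite ?orbT.
  move=> /subset_leq_card/leq_trans; apply.
  by apply: leq_trans (leq_card_setU _ _) _; rewrite leq_add2r leq_card_setU.
pose E := [set z : (D * D) * (D * D) |
  [&& z.1 \in Q, z.2 \in Q & dsum z.1 == dsum z.2]]%SET.
have EQ : (#|E| <= u * #|Q| + #|Z| + 2 * #|U|)%N.
  pose D1 := [set (q, q) | q in Q]%SET.
  pose D2 := (if k == 1 then [set (q, (q.2, q.1)) | q in Q] else finset.set0)%SET.
  pose U1 := [set (t.1, (t.2, t.1.1)) | t in U]%SET.
  pose U2 := [set ((t.2, t.1.1), t.1) | t in U]%SET.
  have sE : E \subset (D1 :|: D2 :|: Z :|: U1 :|: U2)%SET.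
    apply/fintype.subsetP => -[[f g] [f' g']].
    rewrite [(_ \in E)]inE => /and3P[qQ q'Q /eqP E0].
    have := qQ; rewrite !inE/= mem_seq1 andbT => /and3P[/andP[fF gF] fg sfg].
    have := q'Q; rewrite !inE/= mem_seq1 andbT => /and3P[/andP[f'F g'F] f'g' sf'g'].
    have [ff'|ff'] := eqVneq f f'.
      have gg' : g = g' by move: E0; rewrite -ff' => /dsum_injl.
      by rewrite -ff' -gg' (imset_f (fun q => (q, q)) qQ).
    have [gg'|gg'] := eqVneq g g'.
      by move: E0 ff'; rewrite gg' => /dsum_injr ->; rewrite eqxx.
    have [fg'|fg'] := eqVneq f g'.
      have [gf'|gf'] := eqVneq g f'.
        rewrite (_ : _ \in D2) ?orbT//.
        move: E0; rewrite -fg' -gf' => /(dsum_swap fg) k1.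
        rewrite /D2 k1 eqxx; by apply/imsetP; exists (f, g).
      rewrite (_ : _ \in U1) ?orbT//; apply/imsetP; exists ((f, g), f') => //=.
        rewrite inE /chain_triple/= !inE fF gF f'F /= negb_or fg ff' gf'/=.
        by rewrite {2}fg' E0 eqxx.
      by rewrite fg'.
    have [gf'|gf'] := eqVneq g f'.
      rewrite (_ : _ \in U2) ?orbT//; apply/imsetP; exists ((f', g'), f) => //=.
        rewrite inE /chain_triple/= !inE fF g'F f'F /= negb_or f'g' eq_sym ff'.
        by rewrite eq_sym fg'/= -E0 gf' eqxx.
      by rewrite gf'.
    rewrite (_ : sparse_quad _ && _) ?orbT// /sparse_quad/= !inE fF gF f'F g'F.
    by rewrite !negb_or fg ff' fg' gf' gg' f'g' sfg E0 eqxx.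
  have c1 : (#|D1| + #|D2| <= u * #|Q|)%N.
    rewrite /u /sum_multiplicity /D2; case: (k == 1).
      by rewrite mul2n -addnn leq_add// leq_imset_card.
    by rewrite cards0 addn0 mul1n leq_imset_card.
  have c2 : (#|U1| <= #|U|)%N by exact: leq_imset_card.
  have c3 : (#|U2| <= #|U|)%N by exact: leq_imset_card.
  have := subset_leq_card sE.
  have [+ _] := leq_card_setU (D1 :|: D2 :|: Z :|: U1)%SET U2.
  have [+ _] := leq_card_setU (D1 :|: D2 :|: Z)%SET U1.
  have [+ _] := leq_card_setU (D1 :|: D2)%SET Z.
  have [+ _] := leq_card_setU D1 D2.
  lia.
pose s := [seq dsum q | q <- enum Q].
have sQ : size s = #|Q| by rewrite size_map -cardE.
have sE : (\sum_(x <- s) count_mem x s = #|E|)%N.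
  rewrite big_map big_enum/=.
  under eq_bigr => q qQ.
    rewrite count_map -sum1_count big_enum_cond/=.
    over.
  rewrite pair_big_dep/= sum1_card; apply: eq_card => -[q q0].
  by rewrite [LHS]unfold_in/= [RHS]inE/= [dsum q0 == _]eq_sym.
have sI : (size (undup s) <= size (sums F))%N.
  apply: uniq_leq_size; first exact: undup_uniq.
  move=> x; rewrite !mem_undup => /mapP[q]; rewrite mem_enum => qQ ->.
  by apply: map_f; rewrite mem_enum; move: qQ; rewrite inE => /andP[].
move: EQ; have := distinct_values_ge u s; rewrite sQ sE.
have : (u = 1 \/ u = 2)%N.
  by rewrite /u /sum_multiplicity; case: (k == 1); [right|left].
by case=> ->; rewrite ?exp1n; lia.
Qed.
End Collisions.

(** * Expected numbers of coincidences in a power *)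

Section Tensor.
Variables (R : comPzRingType) (n : nat) (X : finType).
Notation D := {ffun 'I_n -> X}.

Lemma tensor_sum2 (phi : 'I_n -> X -> X -> R) :
  \sum_(f : D) \sum_(g : D) \prod_i phi i (f i) (g i) =
  \prod_i \sum_x \sum_y phi i x y.
Proof.
by rewrite bigA_distr_bigA; apply: eq_bigr => f _; rewrite bigA_distr_bigA.
Qed.

Lemma tensor_sum3 (phi : 'I_n -> X -> X -> X -> R) :
  \sum_(f : D) \sum_(g : D) \sum_(h : D) \prod_i phi i (f i) (g i) (h i) =
  \prod_i \sum_x \sum_y \sum_z phi i x y z.
Proof.
rewrite bigA_distr_bigA; apply: eq_bigr => f _.
by rewrite bigA_distr_bigA; apply: eq_bigr => g _; rewrite bigA_distr_bigA.
Qed.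

Lemma prod_indicator (I : finType) (b : pred I) :
  \prod_i (b i)%:R = [forall i, b i]%:R :> R.
Proof.
have [/forallP bT|/forallPn[i bF]] := boolP [forall i, b i].
  by rewrite big1// => i _; rewrite bT.
by rewrite (bigD1 i)//= (negbTE bF) mul0r.
Qed.

End Tensor.

Section Power.
Variables (R : realType) (X : finType) (a : X -> R) (v : X -> int) (k : int).
Hypotheses (a_gt0 : forall x, 0 < a x) (a_le1 : forall x, a x <= 1).
Hypotheses (v_inj : injective v) (k0 : k != 0).

Definition mass : R := \sum_x a x.

Definition base_sum (x y : X) : int := v x + k * v y.

Definition base_dilate (m : int) : R :=
  \sum_x \sum_y a x * a y * (base_sum x y == m)%:R.

(** Sums of [base_dilate] over its support are best written as sums over pairs
    weighted by [a x * a y], which makes [pair_dilate] the relevant quantity. *)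
Definition pair_dilate (x y : X) : R := base_dilate (base_sum x y).

Hypothesis mass_gt1 : 1 < mass.
Hypothesis spartan : \sum_x \sum_y a x * a y * ln (pair_dilate x y) < 0.

Lemma pair_dilate_ge x y : a x * a y <= pair_dilate x y.
Proof.
rewrite /pair_dilate /base_dilate (bigD1 x)//= (bigD1 y)//= eqxx mulr1 -addrA.
rewrite lerDl addr_ge0//; last apply: sumr_ge0 => x' _; apply: sumr_ge0 => y' _;
  by rewrite !mulr_ge0// ltW.
Qed.

Lemma pair_dilate_gt0 x y : 0 < pair_dilate x y.
Proof. by apply: lt_le_trans (pair_dilate_ge x y); rewrite mulr_gt0. Qed.

Lemma sum_pair_mass : \sum_x \sum_y a x * a y = mass ^+ 2.
Proof.
by rewrite expr2 {1}/mass big_distrl/=; apply: eq_bigr => x _; rewrite big_distrr.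
Qed.

(** If [a] were constantly 1, the dilate would be at least 1 on its support. *)
Lemma exists_lt1 : exists x, a x < 1.
Proof.
apply: contrapT => /forallNP a1; move: spartan; apply/negP; rewrite -leNgt.
have {}a1 x : a x = 1.
  by apply/eqP; rewrite eq_le a_le1/= leNgt; apply/negP.
apply: sumr_ge0 => x _; apply: sumr_ge0 => y _.
rewrite !a1 !mul1r ln_ge0//.
by apply: le_trans (pair_dilate_ge x y); rewrite !a1 mul1r.
Qed.

Definition chain_mass : R :=
  \sum_x \sum_y \sum_z a x * a y * a z * (base_sum x y == base_sum z x)%:R.

(** Given [x] and [y] there is at most one [z] with [x + k y = z + k x], and its
    weight is at most 1. The inequality is strict at [y = x] when [a x < 1], as
    then [z = x]. *)
Lemma chain_mass_lt : chain_mass < mass ^+ 2.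
Proof.
have le1 x y : \sum_z a z * (base_sum x y == base_sum z x)%:R <= 1.
  have [[z0 /eqP Ez]|nz] := pselect (exists z, base_sum x y == base_sum z x).
    rewrite (bigD1 z0)//= big1 ?addr0.
      by rewrite Ez eqxx mulr1.
    move=> z zz0; rewrite Ez; case: eqP => [/addIr/v_inj zE|_]; last by rewrite mulr0.
    by rewrite zE eqxx in zz0.
  rewrite big1// => z _; case: (boolP (_ == _)) => h; last by rewrite mulr0.
  by exfalso; apply: nz; exists z.
have E x y : \sum_z a x * a y * a z * (base_sum x y == base_sum z x)%:R =
    a x * a y * \sum_z a z * (base_sum x y == base_sum z x)%:R.
  by rewrite big_distrr/=; apply: eq_bigr => z _; rewrite -!mulrA.
have le2 x y : \sum_z a x * a y * a z * (base_sum x y == base_sum z x)%:R <= a x * a y.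
  by rewrite E -[leRHS]mulr1 ler_wpM2l// mulr_ge0// ltW.
have [x0 ax0] := exists_lt1.
rewrite -sum_pair_mass /chain_mass (bigD1 x0)//= [ltRHS](bigD1 x0)//=.
apply: ltr_leD; last first.
  by apply: ler_sum => x _; apply: ler_sum => y _.
rewrite (bigD1 x0)//= [ltRHS](bigD1 x0)//=.
apply: ltr_leD; last by apply: ler_sum => y _.
rewrite E -[ltRHS]mulr1 ltr_pM2l ?mulr_gt0//.
rewrite (bigD1 x0)//= eqxx mulr1 big1 ?addr0// => z zx.
case: eqP => [/addIr/v_inj zE|_]; last by rewrite mulr0.
by rewrite zE eqxx in zx.
Qed.

Section Dimension.
Variable n : nat.
Notation D := {ffun 'I_n -> X}.

Definition weight (f : D) : R := \prod_i a (f i).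

Definition embed (f : D) : 'rV[int]_n := \row_i v (f i).

(** The value at [f + k g] of the dilate of the power distribution, that is, up to
    the diagonal, the expected number of representations of that sum. *)
Definition power_dilate (q : D * D) : R := \prod_i pair_dilate (q.1 i) (q.2 i).

Lemma weight_gt0 f : 0 < weight f.
Proof. by apply: prodr_gt0. Qed.

Lemma embed_inj : injective embed.
Proof.
move=> f g /matrixP E; apply/ffunP => i; apply: v_inj.
by have := E ord0 i; rewrite !mxE.
Qed.

Lemma sum_weight : \sum_f weight f = mass ^+ n.
Proof.
by rewrite -(@bigA_distr_bigA _ _ _ _ _ _ _ (fun _ x => a x)) prodr_const card_ord.
Qed.

Lemma dsum_embed_eq (f g f' g' : D) :
  (dsum embed k (f, g) == dsum embed k (f', g')) =
  [forall i, base_sum (f i) (g i) == base_sum (f' i) (g' i)].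
Proof.
apply/eqP/forallP => [/matrixP E i|E].
  by apply/eqP; have := E ord0 i; rewrite !mxE.
by apply/matrixP => i j; rewrite !mxE; apply/eqP/E.
Qed.

Lemma power_dilateE (q : D * D) : power_dilate q =
  \sum_(q' : D * D) weight q'.1 * weight q'.2 *
    (dsum embed k q == dsum embed k q')%:R.
Proof.
case: q => f g; rewrite /power_dilate /pair_dilate /base_dilate/= -tensor_sum2.
rewrite pair_bigA/=; apply: eq_bigr => -[f' g'] _ /=.
rewrite !big_split/= prod_indicator; congr (_ * _%:R).
rewrite dsum_embed_eq; congr nat_of_bool.
by apply: eq_forallb => i; rewrite eq_sym.
Qed.

Lemma sum_weight_pair : \sum_(q : D * D) weight q.1 * weight q.2 = (mass ^+ 2) ^+ n.
Proof.
rewrite -(pair_bigA _ (fun f g => weight f * weight g))/= -exprM mulnC exprM expr2.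
rewrite -sum_weight big_distrl/=; apply: eq_bigr => f _; by rewrite big_distrr.
Qed.

Variables (eps s : R).

Definition sparse_pair (q : D * D) : bool := power_dilate q <= expR (- eps) ^+ n.

(** Chernoff bound: the exponential moment is at least 1 on dense pairs and it
    factors over the coordinates. *)
Lemma dense_weight : 0 < s ->
  \sum_(q | dense_pair sparse_pair q) \prod_(f <- undup (pair_pts q)) weight f <=
  (\sum_x \sum_y a x * a y * expR (s * (ln (pair_dilate x y) + eps))) ^+ n.
Proof.
move=> s0.
pose G (q : D * D) := \prod_i expR (s * (ln (pair_dilate (q.1 i) (q.2 i)) + eps)).
apply: (@le_trans _ _ (\sum_(q : D * D) weight q.1 * weight q.2 * G q)).
  rewrite big_mkcond; apply: ler_sum => -[f g] _.
  have wG : 0 <= weight f * weight g * G (f, g).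
    by rewrite !mulr_ge0// ?(ltW (weight_gt0 _))// prodr_ge0// => i _; exact: expR_ge0.
  case: ifP => // /andP[U]; rewrite /sparse_pair -ltNge => dense.
  rewrite (undup_id U)/= big_cons big_seq1 -[leLHS]mulr1 ler_wpM2l//.
    by rewrite mulr_ge0// ltW// weight_gt0.
  rewrite /G -expR_sum -[leLHS]expR0 ler_expR -big_distrr/= pmulr_rge0//.
  rewrite big_split/= sumr_const card_ord.
  have : expR (- eps * n%:R) < expR (\sum_i ln (pair_dilate (f i) (g i))).
    rewrite expR_sum expRM_natr; apply: lt_le_trans dense _.
    apply: ler_prod => i _; rewrite ltW ?pair_dilate_gt0//= lnK//.
    by rewrite posrE pair_dilate_gt0.
  by rewrite ltr_expR mulNr mulr_natr; lra.
rewrite -(pair_bigA _ (fun f g => weight f * weight g * G (f, g)))/=.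
rewrite -[in leRHS](card_ord n) -prodr_const -tensor_sum2.
by do 2 (apply: ler_sum => ? _); rewrite !big_split.
Qed.

(** Summing over the second pair gives the power dilate at the sum of the first
    one, which is exponentially small because the first pair is sparse. *)
Lemma quad_weight :
  \sum_(z | sparse_quad embed k sparse_pair z) \prod_(f <- undup (quad_pts z)) weight f
  <= (expR (- eps) * mass ^+ 2) ^+ n.
Proof.
apply: (@le_trans _ _ (\sum_(q : D * D | sparse_pair q) \sum_(q' : D * D)
    weight q.1 * weight q.2 *
    (weight q'.1 * weight q'.2 * (dsum embed k q == dsum embed k q')%:R))).
  rewrite pair_big_dep big_mkcond [leRHS]big_mkcond.
  apply: ler_sum => -[[f g] [f' g']] _.
  case: ifP => [/and3P[U sp dd]|_].
    rewrite (undup_id U) sp dd/= !big_cons big_nil !mulr1; lra.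
  case: ifP => // _; rewrite !mulr_ge0//; exact/ltW/weight_gt0.
apply: (@le_trans _ _ (\sum_(q : D * D) weight q.1 * weight q.2 * expR (- eps) ^+ n)).
  rewrite big_mkcond; apply: ler_sum => q _.
  have W : 0 <= weight q.1 * weight q.2 by rewrite mulr_ge0// ltW// weight_gt0.
  case: ifP => [sp|_]; last by rewrite mulr_ge0// exprn_ge0// expR_ge0.
  by rewrite -big_distrr/= -power_dilateE ler_wpM2l.
by rewrite -big_distrl/= sum_weight_pair -exprMn mulrC.
Qed.

Lemma triple_weight :
  \sum_(t | chain_triple embed k t) \prod_(f <- undup (triple_pts t)) weight f
  <= chain_mass ^+ n.
Proof.
have -> : chain_mass ^+ n = \sum_(t : D * D * D) weight t.1.1 * weight t.1.2 *
    weight t.2 * (dsum embed k t.1 == dsum embed k (t.2, t.1.1))%:R.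
  rewrite -[in LHS](card_ord n) -prodr_const -tensor_sum3.
  rewrite (pair_bigA _ (fun f g => _))/= (pair_bigA _ (fun q h => _))/=.
  apply: eq_bigr => -[[f g] h] _ /=.
  by rewrite !big_split/= prod_indicator -dsum_embed_eq.
rewrite big_mkcond; apply: ler_sum => -[[f g] h] _.
case: ifP => [/andP[U dd]|_].
  by rewrite (undup_id U) dd/= !big_cons big_nil !mulr1 mulrA.
by rewrite !mulr_ge0//; exact/ltW/weight_gt0.
Qed.

End Dimension.

(** The rate [r] is the largest of four: those of the reciprocal of the mean of
    [#|F|] and, relative to the square of that mean, of the expected numbers of
    dense pairs, sparse quadruples and chain triples. Outside an event of
    probability [O(r ^ n)], [#|F|] is at least half its mean and the exceptional
    configurations, chain triples being counted twice, number less than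
    [#|F| ^ 2 / 4], so that [card_sums_ge] applies. *)
Lemma failure_bound : exists2 r : R, 0 <= r < 1 &
  forall n (p : {set {ffun 'I_n -> X}} -> R),
  (forall F, 0 <= p F) ->
  (forall J : {set {ffun 'I_n -> X}},
     \sum_(F : {set {ffun 'I_n -> X}} | J \subset F) p F = \prod_(f in J) weight f) ->
  \sum_(F | few_sums (@embed n) k F) p F <= 68 * r ^+ n.
Proof.
(* The spartan inequality is strict, so it survives a small shift. *)
have [eps eps0 shift] : exists2 eps : R, 0 < eps &
    \sum_x \sum_y a x * a y * (ln (pair_dilate x y) + eps) < 0.
  have := spartan; set S := (X in X < 0) => S_lt0.
  have M0 : 0 < mass ^+ 2 by rewrite exprn_gt0// (lt_trans _ mass_gt1).
  exists (- S / (2 * mass ^+ 2)); first by rewrite divr_gt0// ?oppr_gt0// mulr_gt0.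
  have -> : \sum_x \sum_y a x * a y * (ln (pair_dilate x y) + - S / (2 * mass ^+ 2)) =
      S + mass ^+ 2 * (- S / (2 * mass ^+ 2)).
    rewrite -sum_pair_mass big_distrl -big_split/=; apply: eq_bigr => x _.
    by rewrite big_distrl -big_split/=; apply: eq_bigr => y _; rewrite mulrDr.
  have -> : S + mass ^+ 2 * (- S / (2 * mass ^+ 2)) = S / 2.
    by field; rewrite gt_eqF// (lt_trans _ mass_gt1).
  lra.
pose M := mass ^+ 2.
have M0 : 0 < M by rewrite exprn_gt0// (lt_trans _ mass_gt1).
have [s s0 rho_lt] : exists2 s : R, 0 < s &
    \sum_x \sum_y a x * a y * expR (s * (ln (pair_dilate x y) + eps)) < M.
  rewrite pair_bigA in shift.
  have [|s s0 lt] := @exists_exp_moment_lt _ _ (fun q : X * X => a q.1 * a q.2)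
    (fun q => ln (pair_dilate q.1 q.2) + eps) _ shift.
    by move=> q; rewrite mulr_ge0// ltW.
  exists s => //; rewrite /M -sum_pair_mass !pair_bigA; exact: lt.
move: rho_lt; set rho := (X in X < M) => rho_lt.
have rho0 : 0 <= rho.
  apply: sumr_ge0 => x _; apply: sumr_ge0 => y _.
  by rewrite !mulr_ge0 ?expR_ge0// ltW.
have ch0 : 0 <= chain_mass.
  do 3 (apply: sumr_ge0 => ? _); by rewrite !mulr_ge0// ltW.
pose r := Num.max (Num.max mass^-1 (rho / M))
  (Num.max (expR (- eps)) (chain_mass / M)).
have r0 : 0 <= r by rewrite !le_max invr_ge0 (le_trans _ (ltW mass_gt1)).
have rA : mass^-1 <= r by rewrite !le_max lexx.
have rB : rho / M <= r by rewrite !le_max lexx orbT.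
have rC : expR (- eps) <= r by rewrite !le_max lexx !orbT.
have rD : chain_mass / M <= r by rewrite !le_max lexx !orbT.
exists r.
  rewrite r0/= !gt_max invf_lt1 ?mass_gt1 ?(lt_trans _ mass_gt1)//=.
  rewrite !ltr_pdivrMr// !mul1r rho_lt chain_mass_lt -[X in _ < X]expR0.
  by rewrite ltr_expR oppr_lt0 eps0.
move=> n p p0 p_incl.
pose D : finType := {ffun 'I_n -> X}.
pose N (F : {set D}) : R := #|F|%:R.
pose mu := mass ^+ n.
have mu0 : 0 < mu by rewrite exprn_gt0// (lt_trans _ mass_gt1).
have muM : mu ^+ 2 = M ^+ n by rewrite /mu /M -!exprM mulnC.
have muV : mu^-1 <= r ^+ n.
  by rewrite /mu -exprVn lerXn2r// nnegrE invr_ge0 ltW// (lt_trans _ mass_gt1).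
(* For a small mean the bound exceeds 1; otherwise #|F| >= 4 whenever it is at
   least half the mean. *)
have [mu8|mu8] := ltP mu 8.
  apply: (@le_trans _ _ 1).
    rewrite -(sum_law p_incl) [leRHS](bigID (few_sums (@embed n) k))/=.
    by rewrite lerDl sumr_ge0.
  apply: (@le_trans _ _ (68 * mu^-1)); last by rewrite ler_pM2l.
  by rewrite ler_pdivlMr//; lra.
pose B (F : {set D}) : nat :=
  #|[set q | dense_pair (sparse_pair eps) q
     & all [in F] (pair_pts q)]%SET|.
pose Z (F : {set D}) : nat :=
  #|[set z | sparse_quad (@embed n) k (sparse_pair eps) z
     & all [in F] (quad_pts z)]%SET|.
pose U (F : {set D}) : nat :=
  #|[set t | chain_triple (@embed n) k t
     & all [in F] (triple_pts t)]%SET|.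
pose W F : R := (B F)%:R + (Z F)%:R + 2 * (U F)%:R.
have EB : \sum_F p F * (B F)%:R <= rho ^+ n.
  by rewrite (expected_count p_incl); exact: dense_weight.
have EZ : \sum_F p F * (Z F)%:R <= (expR (- eps) * M) ^+ n.
  by rewrite (expected_count p_incl); exact: quad_weight.
have EU : \sum_F p F * (U F)%:R <= chain_mass ^+ n.
  by rewrite (expected_count p_incl); exact: triple_weight.
have EW : \sum_F p F * W F <= 4 * (r ^+ n * M ^+ n).
  have bnd x : 0 <= x -> x / M <= r -> x ^+ n <= r ^+ n * M ^+ n.
    move=> x0; rewrite ler_pdivrMr// => xr; rewrite -exprMn lerXn2r// nnegrE.
    exact: le_trans xr.
  have b1 := bnd _ rho0 rB; have b3 := bnd _ ch0 rD.
  have b2 : (expR (- eps) * M) ^+ n <= r ^+ n * M ^+ n.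
    apply: bnd; first by rewrite mulr_ge0 ?expR_ge0// ltW.
    by rewrite mulfK// gt_eqF.
  have -> : \sum_F p F * W F = \sum_F p F * (B F)%:R + \sum_F p F * (Z F)%:R
      + 2 * \sum_F p F * (U F)%:R.
    rewrite big_distrr -!big_split/=; apply: eq_bigr => F _; rewrite /W; ring.
  lra.
have W0 F : 0 <= W F by rewrite !addr_ge0.
have cheb := chebyshev_subset (fun f => ltW (weight_gt0 f)) p0 p_incl.
rewrite sum_weight -/mu in cheb.
have {}cheb := cheb mu0.
have t0 : 0 < mu ^+ 2 / 16 by rewrite divr_gt0// exprn_gt0.
have mark := @markov_subset _ _ _ p0 (mu ^+ 2 / 16) W
  (fun F => mu ^+ 2 / 16 <= W F) t0 W0 (fun F h => h).
apply: (@le_trans _ _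
  (\sum_(F | N F < mu / 2) p F + \sum_(F | mu ^+ 2 / 16 <= W F) p F)).
  rewrite big_mkcond [X in _ <= X + _]big_mkcond [X in _ <= _ + X]big_mkcond/=.
  rewrite -big_split/=; apply: ler_sum => F _.
  case: ifP => [fail|_]; last by rewrite addr_ge0//; case: ifP.
  have [|NF] := ltP (N F) (mu / 2); first by rewrite lerDl; case: ifP.
  have [|WF] := leP (mu ^+ 2 / 16) (W F); first by rewrite add0r.
  exfalso; move: fail; apply/negP; rewrite /few_sums -leqNgt.
  have := card_sums_ge (sparse_pair eps) (@embed_inj n) k0 F.
  rewrite -/(B F) -/(Z F) -/(U F) -(ler_nat R) natrX !natrD !natrM -/(N F).
  rewrite -(ler_nat R) natrX !natrM -/(N F).
  have : W F <= N F ^+ 2 / 4 by nra.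
  have : N F <= N F ^+ 2 / 4 by nra.
  rewrite /W; lra.
(* Chebyshev gives 4 / mu, and Markov 16 times the bound in EW. *)
apply: (@le_trans _ _ (4 / mu + 64 * r ^+ n)).
  apply: lerD => //; apply: (le_trans mark).
  rewrite ler_pdivrMr// muM; apply: (le_trans EW); lra.
have : 0 <= r ^+ n by exact: exprn_ge0.
lra.
Qed.

End Power.

(** * Random sets seen through finitely many points *)

Section Picked.
Variables (d : measure_display) (T : measurableType d) (R : realType).

(** Both the law of the random set on finitely many points and the event that the
    whole random set equals a given finite set are determined in this way. *)
Lemma measurable_section_eq (I : countType) (E : I -> set T) (A : set I) :
  (forall i, measurable (E i)) -> measurable [set w | [set i | E i w] = A].
Proof.
move=> mE.
have -> : [set w | [set i | E i w] = A] =
    ~` (\bigcup_i if `[< A i >] then ~` E i else E i).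
  apply/seteqP; split=> [w <- [i _] /=|w /= nw].
    by case: asboolP.
  apply/seteqP; split=> i.
    move=> /= Eiw; apply: contrapT => nA; apply: nw; exists i => //.
    by rewrite asboolF.
  move=> Ai; apply: contrapT => /= nE; apply: nw; exists i => //.
  by rewrite asboolT.
apply: measurableC; apply: countable_bigcupT_measurable; first exact: countableP.
by move=> i; case: asboolP => _ //; exact: measurableC.
Qed.

Variables (P : probability T R) (I : finType) (E : I -> set T).
Hypothesis mE : forall i, measurable (E i).

Definition picked (w : T) : {set I} := [set i | `[< E i w >]]%SET.

Definition law (F : {set I}) : R := fine (P [set w | picked w = F]).

Lemma measurable_picked_eq (F : {set I}) : measurable [set w | picked w = F].
Proof.
rewrite (_ : mkset _ = [set w | [set i | E i w] = [set` F]]).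
  exact: measurable_section_eq.
apply/seteqP; split => w /=.
  by move=> <-; apply/seteqP; split => i /=; rewrite inE => /asboolP.
move=> EF; apply/setP => i; rewrite inE.
have := congr1 (fun B : set I => B i) EF => /= ->.
by apply/asboolP/idP.
Qed.

Lemma law_ge0 F : 0 <= law F.
Proof. exact/fine_ge0/measure_ge0. Qed.

Lemma picked_bigcup (Q : pred {set I}) :
  [set w | Q (picked w)] = \bigcup_(F in [set` Q]) [set w | picked w = F].
Proof.
apply/seteqP; split => [w Qw|w [F /= QF]]; first by exists (picked w).
by move=> ->.
Qed.

Lemma measurable_picked (Q : pred {set I}) : measurable [set w | Q (picked w)].
Proof.
rewrite picked_bigcup; apply: fin_bigcup_measurable; first exact: finite_finset.
by move=> F _; exact: measurable_picked_eq.
Qed.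

Lemma probability_picked (Q : pred {set I}) :
  P [set w | Q (picked w)] = (\sum_(F | Q F) law F)%:E.
Proof.
rewrite picked_bigcup measure_fin_bigcup.
- rewrite fsbig_finite; last exact: finite_finset.
  rewrite -sumEFin.
  rewrite (perm_big [seq F <- index_enum {set I} | Q F]); last first.
    apply: uniq_perm; first exact: fset_uniq.
      by rewrite filter_uniq// index_enum_uniq.
    move=> F; rewrite in_fset_set; last exact: finite_finset.
    by rewrite mem_filter mem_index_enum andbT; apply/idP/idP; rewrite in_setE.
  rewrite big_filter; apply: eq_big => // F _.
  by rewrite fineK// fin_num_measure//; exact: measurable_picked_eq.
- exact: finite_finset.
- by move=> F G _ _ [w [/= <- <-]].
- by move=> F _; exact: measurable_picked_eq.
Qed.

Lemma law_superset (b : I -> R) :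
  (forall J : {set I}, P (\bigcap_(i in [set` J]) E i) = (\prod_(i in J) b i)%:E) ->
  forall J : {set I}, \sum_(F : {set I} | J \subset F) law F = \prod_(i in J) b i.
Proof.
move=> indep J; apply: EFin_inj; rewrite -indep.
rewrite -(probability_picked (fun F : {set I} => J \subset F)); congr (P _).
apply/seteqP; split => w /=.
  move=> /fintype.subsetP JF i /= /JF; by rewrite inE => /asboolP.
by move=> JE; apply/fintype.subsetP => i iJ; rewrite inE; apply/asboolP/JE.
Qed.

End Picked.

Section LargeSumset.
Variables (d : measure_display) (T : measurableType d) (R : realType).
Variables (n : nat) (c : R) (k : int).

Definition large_set (A : set 'rV[int]_n) : Prop :=
  (c%:E * counting A ^+ 2 <= counting (sumset_dilate A k A))%E.

(** Both sides are then infinite, the sumset containing a translate of [A]. *)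
Lemma large_infinite (A : set 'rV[int]_n) : infinite_set A -> large_set A.
Proof.
move=> infA; have [a0 Aa0] := infinite_setN0 infA.
rewrite /large_set [X in (_ <= X)%E]/counting asboolF ?leey//.
apply: contra_not infA => finAA.
apply: (@sub_finite_set _ _ ((fun a => a + k *: a0) @^-1` sumset_dilate A k A)).
  by move=> a Aa /=; exists a => //; exists a0.
by apply: finite_preimage => // a b _ _; exact: addIr.
Qed.

(** By [large_infinite] the complement requires [S w] to be one of the countably
    many finite sets. *)
Lemma measurable_large_sumset (S : T -> set 'rV[int]_n) :
  (forall x, measurable [set w | S w x]) -> measurable (large_sumset c k S).
Proof.
move=> mS.
have -> : large_sumset c k S = ~` (\bigcup_(F : {fset 'rV[int]_n})
    if `[< large_set [set` F] >] then set0 else [set w | S w = [set` F]]).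
  apply/seteqP; split => [w Lw [F _]|w /= nw].
    by case: asboolP => // nL /= SF; apply: nL; rewrite -SF.
  have [finS|/large_infinite//] := pselect (finite_set (S w)).
  apply: contrapT => nL; apply: nw; exists (fset_set (S w)) => //.
  by rewrite fset_setK// asboolF.
apply: measurableC; apply: countable_bigcupT_measurable; first exact: countableP.
move=> F; case: asboolP => _ //.
exact: (measurable_section_eq (E := fun x => [set w | S w x])).
Qed.

End LargeSumset.

(** * Cardinalities of finite sumsets *)

Lemma counting_seq (R : realType) (V : choiceType) (s : seq V) :
  uniq s -> counting [set` s] = (size s)%:R%:E :> \bar R.
Proof.
move=> us; rewrite /counting asboolT; last exact: finite_seq.
have -> : [set` s] = [set` seq_fset tt s].
  by apply/seteqP; split => x /=;
    have -> : (x \in seq_fset tt s) = (x \in s) by exact: seq_fsetE.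
by rewrite set_fsetK size_seq_fset undup_id.
Qed.

Section SumsetCardinality.
Variables (R : realType) (n : nat) (D : finType) (e : D -> 'rV[int]_n) (k : int).
Hypothesis e_inj : injective e.

Lemma counting_image (F : {set D}) :
  counting (e @` [set` F]) = #|F|%:R%:E :> \bar R.
Proof.
have -> : e @` [set` F] = [set` map e (enum F)].
  apply/seteqP; split => x /=.
    by move=> [f fF <-]; apply: map_f; rewrite mem_enum.
  by move=> /mapP[f]; rewrite mem_enum => fF ->; exists f.
by rewrite counting_seq ?size_map -?cardE// map_inj_uniq// enum_uniq.
Qed.

Lemma counting_sumset (F : {set D}) :
  counting (sumset_dilate (e @` [set` F]) k (e @` [set` F])) =
  (size (sums e k F))%:R%:E :> \bar R.
Proof.
rewrite -counting_seq ?undup_uniq//; congr counting.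
apply/seteqP; split => x /=.
  move=> [_ [f /= fF <-]] [_ [g /= gF <-]] <-.
  rewrite mem_undup; apply/mapP; exists (f, g) => //.
  by rewrite mem_enum inE/= fF.
rewrite mem_undup => /mapP[[f g]]; rewrite mem_enum inE/= => /andP[fF gF] ->.
by exists (e f); [exists f|exists (e g); [exists g|]].
Qed.

End SumsetCardinality.

(** * Fractional sets as weights on their support *)

Section FractionalSet.
Variables (R : realType) (alpha : int -> R) (k : int).
Hypothesis halpha : fractional_set alpha.

Definition support_fset : {fset int} := fset_set (supp alpha).
Definition density (x : support_fset) : R := alpha (val x).
Definition coord (x : support_fset) : int := val x.

Lemma mem_support_fset (x : int) : (x \in support_fset) = (alpha x != 0).
Proof.
have [[fin _] _] := halpha; rewrite in_fset_set//.
by apply/idP/idP; rewrite in_setE.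
Qed.

Lemma density_gt0 x : 0 < density x.
Proof.
have [[_ ge0] _] := halpha.
by rewrite /density lt_def ge0 andbT -mem_support_fset; exact: valP.
Qed.

Lemma density_le1 x : density x <= 1.
Proof. by have [_] := halpha; apply. Qed.

(** The sum defining the size at [p = 1] is the mass. *)
Lemma mass_gt1_of_size : 1 < dilate_size alpha -> 1 < mass density.
Proof.
have [[fin ge0] _] := halpha.
move=> /lt_le_trans; apply; apply: ge_inf.
  exists 0 => _ [p _ <-]; rewrite fsbig_finite//=.
  by apply: sumr_ge0 => x _; exact: powR_ge0.
exists 1; first by rewrite /= in_itv/= ler01 lexx.
rewrite fsbig_finite//= /mass big_seq_fsetE/=; apply: eq_bigr => x _.
by rewrite powRr1.
Qed.

Lemma dilate_addE (m : int) :
  dilate_add alpha k alpha m = base_dilate density coord k m.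
Proof.
have [[fin _] _] := halpha.
rewrite /dilate_add fsbig_mkcond.
transitivity (\sum_(p \in supp alpha `*` supp alpha)
    alpha p.1 * alpha p.2 * (p.1 + k * p.2 == m)%:R).
  rewrite [RHS](@fsbig_widen _ _ _ _ _ setT)//.
    apply: eq_fsbigr => -[x y] _; rewrite patchE/=; case: eqP => xy.
      by rewrite mem_set// mulr1.
    by rewrite memNset// mulr0.
  move=> [x y] [_] /= nxy; have [x0|x0] := eqVneq (alpha x) 0.
    by rewrite x0 !mul0r.
  have [y0|y0] := eqVneq (alpha y) 0; first by rewrite y0 mulr0 mul0r.
  by exfalso; apply: nxy.
rewrite -(pair_fsbig _ (fun x y => alpha x * alpha y * (x + k * y == m)%:R) fin fin).
rewrite fsbig_finite//= big_seq_fsetE/=; apply: eq_bigr => x _.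
by rewrite fsbig_finite//= big_seq_fsetE.
Qed.

Lemma strictly_spartanE :
  \sum_(m \in supp (dilate_add alpha k alpha))
     dilate_add alpha k alpha m * ln (dilate_add alpha k alpha m) =
  \sum_x \sum_y density x * density y * ln (pair_dilate density coord k x y).
Proof.
pose M := undup [seq base_sum coord k q.1 q.2 |
  q <- index_enum (support_fset * support_fset)%type].
have inM x y : base_sum coord k x y \in M.
  by rewrite mem_undup; apply/mapP; exists (x, y); rewrite ?mem_index_enum.
have L m : m \notin M -> base_dilate density coord k m = 0.
  move=> mM; rewrite /base_dilate big1// => x _; rewrite big1// => y _.
  by case: eqP => [xy|]; [rewrite -xy inM in mM|rewrite mulr0].
rewrite (@fsbig_widen _ _ _ _ _ [set` M]).
- rewrite -fsbig_seq ?undup_uniq//=.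
  under eq_bigr => m _ do rewrite !dilate_addE {1}/base_dilate big_distrl/=.
  rewrite exchange_big/=; apply: eq_bigr => x _.
  under eq_bigr => m _ do rewrite big_distrl/=.
  rewrite exchange_big/=; apply: eq_bigr => y _.
  rewrite (bigD1_seq (base_sum coord k x y)) ?undup_uniq//= eqxx mulr1 big1 ?addr0//.
  by move=> m /negbTE; rewrite eq_sym => ->; rewrite mulr0 mul0r.
- move=> m /=; rewrite /supp/= dilate_addE; apply: contraNT => /L ->.
  by rewrite eqxx.
- by move=> m [_] /= /negP; rewrite negbK => /eqP ->; rewrite mul0r.
Qed.

End FractionalSet.

(** * From the law of the trace to the probability space *)

Section Transfer.
Variables (R : realType) (alpha : int -> R) (k : int).
Hypothesis halpha : fractional_set alpha.
Variables (d : measure_display) (T : measurableType d) (P : probability T R).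
Variables (n : nat) (S : T -> set 'rV[int]_n).
Hypothesis hS : drawn_from_power P alpha S.

Notation D := {ffun 'I_n -> support_fset alpha}.
Notation e := (embed (n := n) (@coord R alpha)).

Definition point_event (f : D) : set T := [set w | S w (e f)].

Lemma measurable_point_event f : measurable (point_event f).
Proof. by have [mS _ _] := hS; exact: mS. Qed.

Lemma coord_inj : injective (@coord R alpha).
Proof. exact: val_inj. Qed.

Lemma law_point_event (J : {set D}) :
  \sum_(F : {set D} | J \subset F) law P point_event F =
  \prod_(f in J) weight (@density R alpha) f.
Proof.
move: J; apply: law_superset; first exact: measurable_point_event.
move=> J; have [_ PS indep] := hS.
have e_inj : injective e := embed_inj coord_inj (n := n).
have := indep (seq_fset tt [seq e f | f <- enum J]).
have memJ x : (x \in seq_fset tt [seq e f | f <- enum J]) =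
    (x \in [seq e f | f <- enum J]) by exact: seq_fsetE.
have -> : \bigcap_(i in [set` seq_fset tt [seq e f | f <- enum J]]) [set w | S w i] =
    \bigcap_(f in [set` J]) point_event f.
  apply/seteqP; split => w /= Sw.
    by move=> f /= fJ; apply: Sw; rewrite /= memJ map_f// mem_enum.
  move=> x /=; rewrite memJ => /mapP[f]; rewrite mem_enum => fJ ->.
  exact: (Sw f).
move=> ->; rewrite (perm_big [seq e f | f <- enum J]); last first.
  rewrite -[X in perm_eq _ X]undup_id ?seq_fset_perm//.
  by rewrite map_inj_uniq// enum_uniq.
rewrite big_map big_enum/= -prodEFin; apply: eq_bigr => f _.
by rewrite PS; congr EFin; apply: eq_bigr => i _; rewrite mxE.
Qed.

(** A point with a coordinate off the support has probability 0, and there are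
    countably many points. *)
Lemma outside_negligible :
  exists N : set T, [/\ measurable N, P N = 0%E &
    forall w, ~ N w -> S w = e @` [set` picked point_event w]].
Proof.
have [mS PS _] := hS.
pose Z (m : nat) : set T := if (choice.unpickle m : option 'rV[int]_n) is Some x then
  if `[< range e x >] then set0 else [set w | S w x] else set0.
have mZ m : measurable (Z m).
  by rewrite /Z; case: (choice.unpickle m) => // x; case: asboolP.
have PZ m : P (Z m) = 0%E.
  rewrite /Z; case: (choice.unpickle m) => [x|]; last exact: measure0.
  case: asboolP => [_|nx]; first exact: measure0.
  rewrite PS; congr EFin.
  have [/forallP xX|/forallPn[i xi]] :=
    boolP [forall i, x ord0 i \in support_fset alpha].
    exfalso; apply: nx; exists [ffun i => [` xX i]%fset] => //.
    by apply/matrixP => j i; rewrite !mxE ffunE [j]ord1.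
  rewrite (bigD1 i)//=; move: xi; rewrite mem_support_fset// negbK => /eqP ->.
  by rewrite mul0r.
exists (\bigcup_m Z m); split.
- exact: bigcup_measurable.
- apply: measure_negligible; first exact: bigcup_measurable.
  apply: negligible_bigcup => m; exists (Z m); split => //; exact: PZ.
- move=> w nZ; apply/seteqP; split => [x Sx|_ [f /= + <-]]; last first.
    by rewrite inE => /asboolP.
  have [[f _ fx]|nx] := pselect (range e x).
    by exists f => //=; rewrite inE; apply/asboolP; rewrite /point_event/= fx.
  exfalso; apply: nZ; exists (choice.pickle x) => //.
  by rewrite /Z choice.pickleK asboolF.
Qed.

Lemma probability_large_sumset_ge (b : R) :
  \sum_(F : {set D} | few_sums e k F) law P point_event F <= b ->
  (1 - b%:E <= P (large_sumset ((2 * sum_multiplicity k)%:R^-1 : R) k S))%E.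
Proof.
move=> lawb; set u := sum_multiplicity k.
have u0 : (0 < u)%N by rewrite /u /sum_multiplicity; case: (k == 1).
have [N [mN PN SN]] := outside_negligible.
have [mS _ _] := hS.
pose fails : pred {set D} := few_sums e k.
have mf := measurable_picked measurable_point_event fails.
have mL := measurable_large_sumset ((2 * u)%:R^-1 : R) k mS.
have : (P setT <= P (large_sumset ((2 * u)%:R^-1 : R) k S) + P N +
         P [set w | fails (picked point_event w)])%E.
  apply: (@le_trans _ _ (P (large_sumset ((2 * u)%:R^-1 : R) k S `|` N `|`
    [set w | fails (picked point_event w)]))).
    apply: le_measure; rewrite ?inE//.
      by apply: measurableU => //; exact: measurableU.
    move=> w _; have [Nw|Nw] := pselect (N w); first by left; right.
    have [Fw|Fw] := boolP (fails (picked point_event w)); first by right.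
    left; left; rewrite /large_sumset/= SN//.
    rewrite counting_image ?counting_sumset; last exact: (embed_inj coord_inj).
    rewrite -!EFinM lee_fin ler_pdivrMl ?ltr0n ?muln_gt0//.
    by rewrite -!natrM ler_nat mulnn leqNgt.
  apply: le_trans (measureU2 _ _ _) _ => //; first exact: measurableU.
  by rewrite leeD2r// measureU2.
rewrite probability_setT PN adde0 (probability_picked P measurable_point_event fails) => h.
rewrite leeBlDr//; apply: (le_trans h).
by rewrite leeD2l// lee_fin.
Qed.

End Transfer.

Unset Implicit Arguments.

(** * The sumset of a strictly spartan random set *)

Theorem theorem5 (R : realType) (alpha : int -> R) (k : int)
    (d : nat -> measure_display) (T : forall n : nat, measurableType (d n))
    (P : forall n : nat, probability (T n) R)
    (S : forall n : nat, T n -> set 'rV[int]_n)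
    (halpha : fractional_set alpha)
    (hsize : 1 < dilate_size alpha)
    (hk : k != 0)
    (hS : forall n : nat, (1 <= n)%N -> drawn_from_power (P n) alpha (S n))
    (hspartan : strictly_spartan (dilate_add alpha k alpha)) :
  (k != 1 -> P n (large_sumset (2%:R^-1 : R) k (S n)) @[n --> \oo] --> (1 : \bar R)%E) /\
  (k = 1 -> P n (large_sumset (4%:R^-1 : R) k (S n)) @[n --> \oo] --> (1 : \bar R)%E).
Proof.
move: hspartan; rewrite /strictly_spartan strictly_spartanE// => spartan.
have [r /andP[r0 r1] fail] := failure_bound (density_gt0 halpha) (density_le1 halpha)
  (@coord_inj R alpha) hk (mass_gt1_of_size halpha hsize) spartan.
have main : P n (large_sumset ((2 * sum_multiplicity k)%:R^-1 : R) k (S n))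
    @[n --> \oo] --> 1%E.
  apply: (@squeeze_cvge _ _ _ _ (fun n => (1 - 68 * r ^+ n)%:E) _ (fun=> 1%E)).
  - near=> n.
    have hSn : drawn_from_power (P n) alpha (S n).
      by apply: hS; near: n; exact: nbhs_infty_gt.
    apply/andP; split.
      rewrite EFinB; apply: (probability_large_sumset_ge halpha hSn).
      apply: fail => [F|J]; first exact: law_ge0.
      exact: (law_point_event hSn).
    apply: probability_le1; apply: measurable_large_sumset.
    by have [] := hSn.
  - apply: cvg_EFin; first by near=> n.
    rewrite -[X in _ --> X](subr0 1) -(mulr0 68).
    apply: cvgB; first exact: cvg_cst.
    apply: cvgM; first exact: cvg_cst.
    by apply: cvg_expr; rewrite ger0_norm.
  - exact: cvg_cst.
split => [k1|k1]; move: main; rewrite /sum_multiplicity.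
  by rewrite (negbTE k1).
by rewrite k1 eqxx.
Unshelve. all: by end_near. Qed.
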